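(* Assume that $X[\mathcal{T}]$ is a locally convex topological vector space whose topology is generated by a filtering family of seminorms $\langle\|\cdot\|_i\rangle_{i\in I}$; $|||\cdot|||$ is a seminorm on $X$ that is $\mathcal{T}$-lower-semicontinuous; $\langle X_k\rangle_{k\in\mathbb{N}}$ is a non-decreasing sequence of $\mathcal{T}$-closed vector subspaces whose union is $X$; $C_k=X_k\cap\{x:|||x|||\le k\}$ for each $k\in\mathbb{N}$; $C_k[\mathcal{T}|_{C_k}]$ is sequential for each $k\in\mathbb{N}$; $\mathcal{C}=\{C_k:k\in\mathbb{N}\}$; $Y\subseteq X$ is a vector subspace that is uniformly sequentially $\mathcal{T}_{\mathcal{C}}$-dense in $X$, with associated $\gamma:\mathbb{N}\to\mathbb{N}$ and $\Gamma>0$; and $f:Y\to\mathbb{R}$ is a linear function satisfying: for every $\varepsilon>0$ there exist $i\in I$ and $\theta>0$ such that for all $y\in Y\cap X_{\lceil\varepsilon^{-1}\rceil}$, $|f(y)|\le\theta\|y\|_i+\varepsilon|||y|||$. Then there exists a $\mathcal{T}_{\mathcal{C}}$-continuous linear function $\hat f:X\to\mathbb{R}$ whose restriction to $Y$ is $f$ and such that for all $k\in\mathbb{N}$ $$\sup_{x\in C_k}|\hat f(x)|\le\sup_{y\in Y\cap C_l}|f(y)|\quad\text{where } l=\max\{\lceil\Gamma k\rceil,\gamma(k)\}$$ (suprema understood in $[0,\infty]$).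
   Context: All vector spaces are real; topological vector spaces are Hausdorff. $\mathbb{N}=\{1,2,\dots\}$. $X[\mathcal{T}]$ denotes $X$ equipped with the topology $\mathcal{T}$; $\mathcal{T}|_C=\{E\cap C:E\in\mathcal{T}\}$. A family of seminorms generates a locally convex topology in the usual way (it is separating, and finite intersections of closed seminorm balls centred at $0$ form a local base); it is filtering if for all $i_1,\dots,i_N\in I$ there is $i\in I$ with $\max_n\|\cdot\|_{i_n}\le\|\cdot\|_i$. A Hausdorff space is sequential if every sequentially closed set is closed. A localizing family in $X$ is a non-empty collection $\mathcal{C}$ of convex subsets of $X$ containing $0$ such that for all $C\in\mathcal{C}$, $x\in X$, $t\in\mathbb{R}$ there is $D\in\mathcal{C}$ with $x+t\cdot C\subseteq D$ (the family of the claim is one). The localization $\mathcal{T}_{\mathcal{C}}$ is the locally convex vector topology on $X$ consisting of all $E\subseteq X$ such that for every $x\in E$ there is a convex $V$ with $x\in V\subseteq E$ and $V\cap C\in\mathcal{T}|_C$ for every $C\in\mathcal{C}$. A vector subspace $Y\subseteq X$ is uniformly sequentially $\mathcal{T}_{\mathcal{C}}$-dense in $X$ (with associated $\gamma$ and $\Gamma$) if there exist $\gamma:\mathbb{N}\to\mathbb{N}$ and $\Gamma>0$ such that for every $k\in\mathbb{N}$ and every $x\in X_k$ there is a sequence $\langle y_j\rangle_j$ in $Y\cap X_{\gamma(k)}$ that $\mathcal{T}$-converges to $x$ and satisfies $\sup_j|||y_j|||\le\Gamma\cdot|||x|||$. *)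

(* Defs.v *)
From HB Require Import structures.
From mathcomp Require Import all_boot all_order all_algebra.
From mathcomp Require Import all_classical all_reals all_analysis.

Set Implicit Arguments.
Unset Strict Implicit.
Unset Printing Implicit Defensive.

Import Order.TTheory GRing.Theory Num.Theory.
Import numFieldNormedType.Exports.

Local Open Scope classical_set_scope.
Local Open Scope ring_scope.

(* Sequences indexed by {1, 2, ...} are functions on nat constrained, and used,
   only at positive indices. *)

Definition seminorm (R : realType) (X : lmodType R) (q : X -> R) : Prop :=
  (forall (a : R) (x : X), q (a *: x) = `|a| * q x) /\
  (forall x y : X, q (x + y) <= q x + q y).

(* A finite family of balls is given by its size m, its indices i and its
   radii r; for m = 0 the intersection is the whole space. *)
Definition generates_topology (R : realType) (X : tvsType R) (I : Type)
    (p : I -> X -> R) : Prop :=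
  [/\ forall i, seminorm (p i),
      forall x : X, (forall i, p i x = 0) -> x = 0 &
      forall U : set X, nbhs (0 : X) U <->
        exists (m : nat) (i : 'I_m -> I) (r : 'I_m -> R),
          (forall j, 0 < r j) /\ [set x | forall j, p (i j) x <= r j] `<=` U].

Definition filtering (R : realType) (X : Type) (I : Type)
    (p : I -> X -> R) : Prop :=
  forall (m : nat) (i : 'I_m.+1 -> I),
    exists i0 : I, forall (j : 'I_m.+1) (x : X), p (i j) x <= p i0 x.

Definition linear_subspace (R : realType) (X : lmodType R) (A : set X) : Prop :=
  submod_closed [pred x | x \in A].

(* Linearity of the restriction of f to a subspace Y; the values of f outside
   Y are irrelevant. *)
Definition linear_on (R : realType) (X : lmodType R) (Y : set X) (f : X -> R)
    : Prop :=
  forall (a : R) (u v : X), Y u -> Y v -> f (a *: u + v) = a * f u + f v.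

Definition seq_closed (T : topologicalType) (A : set T) : Prop :=
  forall (u : nat -> T) (l : T),
    (forall n, A (u n)) -> u @ \oo --> l -> A l.

Definition sequential_space (T : topologicalType) : Prop :=
  forall A : set T, seq_closed A -> closed A.

(* A copy of X that carries the localization of the topology of X by CC. *)
Definition localization (R : realType) (X : tvsType R) (CC : set (set X))
    : Type := X.

Section Localization.
Variables (R : realType) (X : tvsType R) (CC : set (set X)).

Definition localization_open (E : set X) : Prop :=
  forall x, E x -> exists V : set X,
    [/\ convex_set V, V x, V `<=` E &
        forall C, CC C -> exists2 W : set X, open W & V `&` C = W `&` C].

Lemma localization_openT : localization_open setT.
Proof.
move=> x _; exists setT; split => // C _.
by exists setT => //; exact: openT.
Qed.

Lemma localization_openI (A B : set X) :
  localization_open A -> localization_open B -> localization_open (A `&` B).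
Proof.
move=> oA oB x [Ax Bx].
have [V [cV Vx VA VC]] := oA _ Ax; have [W [cW Wx WB WC]] := oB _ Bx.
exists (V `&` W); split => //.
- move=> y z l /[!inE] -[Vy Wy] [Vz Wz].
  by split; apply/set_mem; [apply: cV|apply: cW]; exact/mem_set.
- by move=> y [/VA Ay /WB By].
- move=> C CCC; have [V' oV' eV] := VC _ CCC; have [W' oW' eW] := WC _ CCC.
  exists (V' `&` W'); first exact: openI.
  by rewrite -[in LHS](setIid C) setIACA eV eW setIACA setIid.
Qed.

Lemma localization_open_bigU (J : Type) (F : J -> set X) :
  (forall j, localization_open (F j)) -> localization_open (\bigcup_j F j).
Proof.
move=> oF x [j _ Fx]; have [V [cV Vx VF VC]] := oF j x Fx.
by exists V; split => // y /VF Fy; exists j.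
Qed.

HB.instance Definition _ := GRing.Lmodule.copy (localization CC) X.
HB.instance Definition _ := isOpenTopological.Build (localization CC)
  localization_openT localization_openI localization_open_bigU.

End Localization.

Definition Cset (R : realType) (X : lmodType R) (Xs : nat -> set X)
    (N : X -> R) (k : nat) : set X :=
  Xs k `&` [set x | N x <= k%:R].

Definition Cfamily (R : realType) (X : lmodType R) (Xs : nat -> set X)
    (N : X -> R) : set (set X) :=
  [set Cset Xs N k | k in [set k | (0 < k)%N]].

Definition uniformly_sequentially_dense (R : realType) (X : tvsType R)
    (Xs : nat -> set X) (N : X -> R) (Y : set X) (gamma : nat -> nat)
    (Gamma : R) : Prop :=
  [/\ forall k, (0 < k)%N -> (0 < gamma k)%N,
      0 < Gamma &
      forall (k : nat) (x : X), (0 < k)%N -> Xs k x ->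
        exists y : nat -> X,
          [/\ forall j, (Y `&` Xs (gamma k)) (y j),
              y @ \oo --> x &
              (ereal_sup (range (fun j => (N (y j))%:E))
                 <= (Gamma * N x)%:E)%E]].

(* The ceiling of x when 0 <= x; the absolute value only casts to nat. *)
Definition nat_ceil (R : realType) (x : R) : nat := `|Num.ceil x|%N.

(* Main.v *)
From HB Require Import structures.
Require Import Defs.
From mathcomp Require Import all_boot all_order all_algebra.
From mathcomp Require Import all_classical all_reals all_analysis.
From mathcomp Require Import lra.
Import Order.TTheory GRing.Theory Num.Theory.
Import numFieldNormedType.Exports.
Local Open Scope classical_set_scope.
Local Open Scope ring_scope.

(* The extension is the limit of f along any N-bounded sequence of Y, contained
   in a single X_m, that converges to x.  Taking eps small in the hypothesis
   on f makes the term eps * N y negligible on an N-bounded part of Y in X_m, so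
   there |f| is small as soon as one seminorm p_i is small: the limit exists,
   does not depend on the sequence, and inherits the estimate on the N-bounded
   subsets of each X_k.  Applied to differences of points of C_k, the inherited
   estimate directly gives topological continuity on C_k. *)

(** * Elementary facts on seminorms *)

Section Seminorms.
Set Implicit Arguments.
Unset Strict Implicit.
Variables (R : realType) (X : lmodType R) (q : X -> R).
Hypothesis semiq : seminorm q.

Lemma seminorm0 : q 0 = 0.
Proof. by rewrite -[0 in LHS](scale0r 0) semiq.1 normr0 mul0r. Qed.

Lemma seminormN x : q (- x) = q x.
Proof. by rewrite -scaleN1r semiq.1 normrN1 mul1r. Qed.

Lemma seminorm_ge0 x : 0 <= q x.
Proof. by have := semiq.2 x (- x); rewrite subrr seminorm0 seminormN; lra. Qed.

Lemma seminormB x y : q (x - y) <= q x + q y.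
Proof. by rewrite -(seminormN y); exact: semiq.2. Qed.

End Seminorms.

(** * The topology generated by the seminorms *)

Section Generated_topology.
Set Implicit Arguments.
Unset Strict Implicit.
Variables (R : realType) (X : tvsType R) (I : Type) (p : I -> X -> R).
Hypothesis gen : generates_topology p.

Lemma generates_seminorm i : seminorm (p i).
Proof. by case: gen. Qed.

Lemma near_seminorm_le i (x : X) (r : R) :
  0 < r -> \forall z \near x, p i (z - x) <= r.
Proof.
(* A single closed ball, taken as a family of size 1, is a neighbourhood of 0; it is then translated
   to [x]. *)
move=> r0; have nU : nbhs (0 : X) [set z | p i z <= r].
  case: gen => _ _ ->; exists 1%N, (fun=> i), (fun=> r); split => // z.
  by move=> /(_ ord0).
apply: filterS (nbhsT x nU) => _ [z /= pz <-].
by rewrite addrAC subrr add0r.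
Qed.

Lemma cvg_seminorm i (y : nat -> X) (x : X) :
  y @ \oo --> x -> p i (y j - x) @[j --> \oo] --> (0 : R).
Proof.
move=> yx; apply/cvgr0Pnorm_le => e e0.
have : \forall j \near \oo, p i (y j - x) <= e.
  exact: yx _ (near_seminorm_le i x e0).
by apply: filterS => j; rewrite ger0_norm// (seminorm_ge0 (generates_seminorm i)).
Qed.

End Generated_topology.

Lemma le_nat_ceil (R : realType) (x : R) : 0 <= x -> x <= (nat_ceil x)%:R.
Proof.
move=> x0; apply: le_trans (ceil_ge x) _.
rewrite /nat_ceil natr_absz ger0_norm// ceil_ge0.
by apply: lt_le_trans x0; rewrite ltrN10.
Qed.

Section Linear_subspace.
Set Implicit Arguments.
Unset Strict Implicit.
Variables (R : realType) (X : lmodType R) (A : set X).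
Hypothesis subA : linear_subspace A.

Lemma linear_subspaceP (a : R) (u v : X) : A u -> A v -> A (a *: u + v).
Proof.
move=> Au Av; by have [_ /(_ a u v)] := subA; rewrite !inE; exact.
Qed.

Lemma linear_subspaceB (u v : X) : A u -> A v -> A (u - v).
Proof. by move=> Au Av; rewrite addrC -scaleN1r; exact: linear_subspaceP. Qed.

End Linear_subspace.

(** * Limits of [f] along bounded sequences *)

Section Extension.
Set Implicit Arguments.
Unset Strict Implicit.
Variables (R : realType) (X : tvsType R) (I : Type) (p : I -> X -> R).
Variables (N : X -> R) (Xs : nat -> set X) (Y : set X).
Variables (gamma : nat -> nat) (Gamma : R) (f : X -> R).
Hypotheses (gen : generates_topology p) (semiN : seminorm N).
Hypothesis subXs : forall k, (0 < k)%N -> linear_subspace (Xs k).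
Hypothesis monoXs : forall k l, (0 < k)%N -> (k <= l)%N -> Xs k `<=` Xs l.
Hypothesis coverXs : \bigcup_(k in [set k | (0 < k)%N]) Xs k = [set: X].
Hypothesis subY : linear_subspace Y.
Hypothesis denseY : uniformly_sequentially_dense Xs N Y gamma Gamma.
Hypothesis linf : linear_on Y f.
Hypothesis boundf : forall eps : R, 0 < eps ->
  exists (i : I) (theta : R), 0 < theta /\
    forall y : X, (Y `&` Xs (nat_ceil eps^-1)) y ->
      `|f y| <= theta * p i y + eps * N y.

Let semip i : seminorm (p i) := generates_seminorm gen i.

Lemma linear_onB u v : Y u -> Y v -> f (u - v) = f u - f v.
Proof.
by move=> Yu Yv; rewrite addrC -scaleN1r linf// mulN1r addrC.
Qed.

(** The bound on [f] is split into two halves of [d]: [eps] is chosen first, to control [eps * N y]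
    through [M], and [r] afterwards, once [theta] is known. *)
Lemma small_on_bounded (m : nat) (M d : R) : (0 < m)%N -> 0 < d ->
  exists (i : I) (r : R), 0 < r /\ forall y, (Y `&` Xs m) y -> N y <= M ->
    p i y <= r -> `|f y| <= d.
Proof.
move=> m0 d0.
(* The term [m%:R^-1] makes [Xs m] part of the subspace on which the estimate for [eps] holds;
   [|M| + 1] is a positive divisor whatever [M] is. *)
pose eps := Num.min (m%:R^-1) (d / 2 / (`|M| + 1)).
have M1 : 0 < `|M| + 1 by rewrite ltr_wpDl.
have eps0 : 0 < eps.
  by rewrite lt_min invr_gt0 ltr0n m0 !divr_gt0.
have epsM : eps * M <= d / 2.
  apply: (@le_trans _ _ (eps * (`|M| + 1))).
    by rewrite ler_pM2l// ler_wpDr// ler_norm.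
  by rewrite -ler_pdivlMr// ge_min lexx orbT.
have mceil : (m <= nat_ceil eps^-1)%N.
  rewrite -(ler_nat R); apply: le_trans (le_nat_ceil _); last first.
    by rewrite invr_ge0 ltW.
  by rewrite -[leLHS]invrK lef_pV2 ?posrE ?invr_gt0 ?ltr0n// ge_min lexx.
have [i [theta [theta0 H]]] := boundf eps0.
exists i, (d / 2 / theta); split; first by rewrite !divr_gt0.
move=> y [Yy Xy] NM pr; apply: le_trans (H y _) _.
  by split => //; exact: monoXs Xy.
rewrite [leRHS]splitr lerD//; first by rewrite mulrC -ler_pdivlMr.
by apply: le_trans epsM; rewrite ler_pM2l.
Qed.

(** The bounds [m] and [M] may depend on the sequence, which makes the notion stable under linear
    combinations. Convergence is expressed by seminorms, the form that [small_on_bounded] can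
    use. *)
Definition bounded_approx (x : X) (y : nat -> X) : Prop :=
  exists (m : nat) (M : R),
    [/\ (0 < m)%N, forall j, (Y `&` Xs m) (y j), forall j, N (y j) <= M &
        forall i, p i (y j - x) @[j --> \oo] --> (0 : R)].

Lemma bounded_approx_lin (a : R) x x' y y' :
  bounded_approx x y -> bounded_approx x' y' ->
  bounded_approx (a *: x + x') (fun j => a *: y j + y' j).
Proof.
move=> [m [M [m0 Yy NM px]]] [m' [M' [m'0 Yy' NM' px']]].
have mm : (0 < maxn m m')%N by rewrite leq_max m0.
exists (maxn m m'), (`|a| * M + M'); split => //.
- move=> j; have [Yj Xj] := Yy j; have [Yj' Xj'] := Yy' j.
  split; first exact: linear_subspaceP.
  apply: linear_subspaceP; first exact: subXs.
    by apply: monoXs Xj; rewrite ?leq_maxl.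
  by apply: monoXs Xj'; rewrite ?leq_maxr.
- move=> j; apply: le_trans (semiN.2 _ _) _.
  by rewrite semiN.1 lerD// ler_wpM2l.
- move=> i; have h : `|a| * p i (y j - x) + p i (y' j - x')
    @[j --> \oo] --> `|a| * 0 + (0 : R) by apply: cvgD => //; exact: cvgMr.
  rewrite mulr0 addr0 in h.
  apply: squeeze_cvgr (cvg_cst 0) h; near=> j.
  rewrite (seminorm_ge0 (semip i))/=.
  rewrite opprD addrACA -scalerBr -(semip i).1; exact: (semip i).2.
Unshelve. all: by end_near. Qed.

Lemma bounded_approx_near0 y (d : R) : bounded_approx 0 y -> 0 < d ->
  \forall j \near \oo, `|f (y j)| <= d.
Proof.
move=> [m [M [m0 Yy NM px]]] d0.
have [i [r [r0 H]]] := small_on_bounded M m0 d0.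
have /cvgr0Pnorm_le/(_ _ r0) := px i.
by apply: filterS => j; rewrite subr0 => /(le_trans (ler_norm _)); exact: H.
Qed.

Lemma bounded_approx_cvg x y : bounded_approx x y -> cvgn (f \o y).
Proof.
move=> [m [M [m0 Yy NM px]]]; apply/cauchy_cvgP/cauchy_exP => d d0.
have d20 : 0 < d / 2 by rewrite divr_gt0.
(* The Cauchy property concerns differences [y n - y j]: these remain in [Y] and [Xs m], but [N] is
   only bounded by [M + M] on them. *)
have [i [r [r0 H]]] := small_on_bounded (M + M) m0 d20.
have r20 : 0 < r / 2 by rewrite divr_gt0.
have /cvgr0Pnorm_le/(_ _ r20) [n _ near_n] := px i.
have pn j : (n <= j)%N -> p i (y j - x) <= r / 2.
  by move=> nj; apply: le_trans (ler_norm _) (near_n j nj).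
exists (f (y n)); exists n => // j /= nj.
have [Yj Xj] := Yy j; have [Yn Xn] := Yy n.
rewrite -ball_normE /ball_/= -linear_onB//.
apply: (@le_lt_trans _ _ (d / 2)); last by lra.
apply: H.
- by split; apply: linear_subspaceB => //; exact: subXs.
- by apply: le_trans (seminormB semiN _ _) _; exact: lerD.
- rewrite -(subrKA x) -(opprB (y j)).
  apply: le_trans (seminormB (semip i) _ _) _.
  by rewrite [leRHS]splitr lerD// pn.
Qed.

(** The explicit bounds [gamma k] and [Gamma * N x], which [bounded_approx] hides, are kept for the
    quantitative estimates. *)
Lemma dense_approx k x : (0 < k)%N -> Xs k x -> exists y : nat -> X,
  [/\ forall j, (Y `&` Xs (gamma k)) (y j), forall j, N (y j) <= Gamma * N x,
      forall i, p i (y j - x) @[j --> \oo] --> (0 : R) & bounded_approx x y].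
Proof.
move=> k0 Xx; have [gamma0 Gamma0 H] := denseY.
have [y [Yy yx supN]] := H _ _ k0 Xx.
have NM j : N (y j) <= Gamma * N x.
  rewrite -lee_fin; apply: le_trans supN; apply: ereal_sup_ubound.
  by exists j.
exists y; split => // [i|]; first exact: cvg_seminorm.
exists (gamma k), (Gamma * N x); split => //; first exact: gamma0.
by move=> i; exact: cvg_seminorm.
Qed.

(** * The extension and its linearity *)

Lemma in_some_Xs x : exists2 k, (0 < k)%N & Xs k x.
Proof. by have : [set: X] x by []; rewrite -coverXs => -[k]; exists k. Qed.

Lemma bounded_approx_ex x : exists y, bounded_approx x y.
Proof.
by have [k k0 /(dense_approx k0)[y []]] := in_some_Xs x; exists y.
Qed.

Definition extension (x : X) : R :=
  lim (f \o projT1 (cid (bounded_approx_ex x)) @ \oo).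

(** The limit does not depend on the sequence chosen in [extension]: the difference of two
    approximations of [x] approximates 0, and [f] tends to 0 along it. *)
Lemma extension_cvg x y : bounded_approx x y -> f \o y @ \oo --> extension x.
Proof.
move=> xy; rewrite /extension; case: (cid _) => z xz /=.
have fz := bounded_approx_cvg xz.
have diff : (f \o y) - (f \o z) @ \oo --> (0 : R).
  have yz := bounded_approx_lin (-1) xz xy.
  rewrite scaleN1r addrC subrr in yz.
  apply/cvgr0Pnorm_le => d d0.
  apply: filterS (bounded_approx_near0 yz d0) => j.
  have [? [? [_ Yy _ _]]] := xy; have [? [? [_ Yz _ _]]] := xz.
  by rewrite scaleN1r addrC linear_onB//=; [case: (Yy j)|case: (Yz j)].
rewrite -[f \o y](subrK (f \o z)) -[X in _ --> X]add0r; exact: cvgD.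
Qed.

Lemma extension_lin (a : R) x x' :
  extension (a *: x + x') = a * extension x + extension x'.
Proof.
have [y xy] := bounded_approx_ex x; have [y' xy'] := bounded_approx_ex x'.
have h := extension_cvg (bounded_approx_lin a xy xy').
apply: (cvg_unique _ h) => //.
have -> : f \o (fun j => a *: y j + y' j) =
    (fun j => a * (f \o y) j + (f \o y') j).
  have [? [? [_ Yy _ _]]] := xy; have [? [? [_ Yy' _ _]]] := xy'.
  by apply/funext => j /=; rewrite linf//; [case: (Yy j)|case: (Yy' j)].
apply: cvgD; last exact: extension_cvg.
by apply: cvgMr; exact: extension_cvg.
Qed.

HB.instance Definition _ :=
  GRing.isLinear.Build R X R *%R extension extension_lin.

Definition extension_scalar : {scalar X} := extension.

Lemma extension_restrict y : Y y -> extension y = f y.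
Proof.
move=> Yy; have [k k0 Xy] := in_some_Xs y.
(* A point of [Y] is approximated by the constant sequence. *)
apply: (cvg_unique _ (extension_cvg (y := fun=> y) _)) => //.
  exists k, (N y); split => // i; rewrite subrr (seminorm0 (semip i)).
  exact: cvg_cst.
exact: cvg_cst.
Qed.

(** The approximants of [x] lie in [Xs (gamma k)] with [N] at most [Gamma * M], so
    [small_on_bounded] applies to them and its bound passes to the limit. *)
Lemma extension_small (k : nat) (M d : R) : (0 < k)%N -> 0 < d ->
  exists (i : I) (r : R), 0 < r /\ forall x, Xs k x -> N x <= M ->
    p i x <= r -> `|extension x| <= d.
Proof.
move=> k0 d0; have [gamma0 Gamma0 _] := denseY.
have [i [r [r0 H]]] := small_on_bounded (Gamma * M) (gamma0 _ k0) d0.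
(* The other half of [r] absorbs [p i (y j - x)]. *)
exists i, (r / 2); split; first by rewrite divr_gt0.
move=> x Xx NM pr; have [y [Yy Ny py xy]] := dense_approx k0 Xx.
have fy : `|f (y j)| @[j --> \oo] --> `|extension x|.
  by apply: cvg_norm; exact: extension_cvg.
rewrite -(cvg_lim _ fy)//; apply: limr_le; first by apply/cvg_ex; eexists; exact: fy.
have r20 : 0 < r / 2 by rewrite divr_gt0.
have /cvgr0Pnorm_le/(_ _ r20) := py i.
apply: filterS => j /(le_trans (ler_norm _)) pj; apply: H => //.
  by apply: le_trans (Ny j) _; rewrite ler_pM2l.
rewrite -[y j](subrK x); apply: le_trans ((semip i).2 _ _) _.
by rewrite [leRHS]splitr lerD.
Qed.

(** * Continuity for the localization, and the bound on suprema *)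

Lemma convex_preimage_ball (c d : R) :
  convex_set [set z | `|extension z - c| < d].
Proof.
apply/convex_setW => z w /[!inE] /= zd wd l l0 l1.
apply/mem_set; rewrite /= linearD !linearZ/= /unstable.onem.
have t1 : 0 < 1 - l%:num by rewrite subr_gt0.
rewrite (_ : _ - c = l%:num * (extension z - c) +
  (1 - l%:num) * (extension w - c)); last by lra.
apply: le_lt_trans (ler_normD _ _) _; rewrite !normrM.
rewrite (gtr0_norm l0) (gtr0_norm t1).
rewrite (_ : d = l%:num * d + (1 - l%:num) * d); last by lra.
by apply: ltrD; rewrite ltr_pM2l.
Qed.

(** Preimages of balls are convex, as the localization demands, so only their traces on each
    [Cset Xs N k] have to be shown relatively open. *)
Lemma extension_continuous :
  continuous (extension : localization (Cfamily Xs N) -> R).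
Proof.
apply/continuousP => A oA.
change (localization_open (Cfamily Xs N) (extension @^-1` A)) => x Ax.
have /nbhs_ballP[d /= d0 dA] : nbhs (extension x) A by exact: open_nbhs_nbhs.
exists [set z | `|extension z - extension x| < d]; split.
- exact: convex_preimage_ball.
- by rewrite /= subrr normr0.
- by move=> z /= zd; apply: dA; rewrite -ball_normE /ball_/= distrC.
move=> C [k k0 <-].
set V := [set z | _].
(* The largest open set whose trace on C_k is contained in V. *)
exists (V `|` ~` Cset Xs N k)^°; first exact: open_interior.
rewrite eqEsubset; split=> z []; last first.
  by move=> /interior_subset[Vz Cz|nC Cz]; [|case: (nC Cz)].
move=> Vz Cz; split => //.
(* Half of the remaining gap, so that the final inequality is strict. *)
pose e := (d - `|extension z - extension x|) / 2.
have e0 : 0 < e by rewrite divr_gt0// subr_gt0.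
(* The bound is doubled because it is applied to [w - z], with [w] and [z] both in [Cset Xs N k]. *)
have [i [r [r0 H]]] := extension_small (k%:R + k%:R) k0 e0.
apply: filterS (near_seminorm_le gen i z r0) => w pw.
have [Cw|] := pselect (Cset Xs N k w); last by right.
left; have [Xw Nw] := Cw; have [Xz Nz] := Cz.
rewrite /V/= -(subrKA (extension z)); apply: le_lt_trans (ler_normD _ _) _.
have /H : Xs k (w - z) by apply: linear_subspaceB => //; exact: subXs.
have NN : N (w - z) <= k%:R + k%:R.
  by apply: le_trans (seminormB semiN _ _) _; exact: lerD.
move=> /(_ NN pw); rewrite linearB/= => hw.
have : `|extension z - extension x| < d by [].
by move: hw; rewrite /e; lra.
Qed.

(** The index [l] is large enough for all approximants of a point of [Cset Xs N k] to lie in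
    [Cset Xs N l]: [gamma k] handles the subspace and the ceiling handles [N]. *)
Lemma extension_sup k : (0 < k)%N ->
  let l := maxn (nat_ceil (Gamma * k%:R)) (gamma k) in
  (ereal_sup [set (`|extension x|)%:E | x in Cset Xs N k]
     <= ereal_sup [set (`|f y|)%:E | y in Y `&` Cset Xs N l])%E.
Proof.
move=> k0 /=; have [gamma0 Gamma0 _] := denseY.
apply: ge_ereal_sup => _ [x [Xx Nx] <-].
have [y [Yy Ny py xy]] := dense_approx k0 Xx.
have fy : (`|f (y j)|)%:E @[j --> \oo] --> (`|extension x|)%:E.
  by apply: cvg_EFin; [exact: nearW|exact: (cvg_norm (extension_cvg xy))].
rewrite -(cvg_lim _ fy)//; apply: lime_le; first by apply/cvg_ex; eexists; exact: fy.
apply: nearW => j; apply: ereal_sup_ubound; exists (y j) => //.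
have [Yj Xj] := Yy j; split => //; split.
  by apply: monoXs Xj; [exact: gamma0|rewrite leq_maxr].
apply: le_trans (Ny j) _; apply: (@le_trans _ _ (Gamma * k%:R)).
  by rewrite ler_pM2l.
apply: (@le_trans _ _ (nat_ceil (Gamma * k%:R))%:R).
  by apply: le_nat_ceil; rewrite mulr_ge0// ltW.
by rewrite ler_nat leq_maxl.
Qed.

End Extension.

Theorem theorem5p7 (R : realType) (X : tvsType R) (I : Type) (p : I -> X -> R)
    (N : X -> R) (Xs : nat -> set X) (Y : set X) (gamma : nat -> nat)
    (Gamma : R) (f : X -> R)
    (hausdorffX : hausdorff_space X)
    (gen : generates_topology p) (filt : filtering p)
    (semiN : seminorm N) (lscN : lower_semicontinuous (fun x : X => (N x)%:E))
    (subXs : forall k, (0 < k)%N -> linear_subspace (Xs k))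
    (closedXs : forall k, (0 < k)%N -> closed (Xs k))
    (monoXs : forall k l, (0 < k)%N -> (k <= l)%N -> Xs k `<=` Xs l)
    (coverXs : \bigcup_(k in [set k | (0 < k)%N]) Xs k = [set: X])
    (seqC : forall k, (0 < k)%N -> sequential_space (set_type (Cset Xs N k)))
    (subY : linear_subspace Y)
    (denseY : uniformly_sequentially_dense Xs N Y gamma Gamma)
    (linf : linear_on Y f)
    (boundf : forall eps : R, 0 < eps ->
       exists (i : I) (theta : R), 0 < theta /\
         forall y : X, (Y `&` Xs (nat_ceil eps^-1)) y ->
           `|f y| <= theta * p i y + eps * N y) :
  exists fhat : {scalar X},
    [/\ continuous (fhat : localization (Cfamily Xs N) -> R),
        forall y : X, Y y -> fhat y = f y &
        forall k, (0 < k)%N ->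
          let l := maxn (nat_ceil (Gamma * k%:R)) (gamma k) in
          (ereal_sup [set (`|fhat x|)%:E | x in Cset Xs N k]
             <= ereal_sup [set (`|f y|)%:E | y in Y `&` Cset Xs N l])%E].
Proof.
exists (extension_scalar gen semiN subXs monoXs coverXs subY denseY linf boundf); split.
- exact: extension_continuous.
- exact: extension_restrict.
- exact: extension_sup.
Qed.
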